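(* Let $\pi_0$ be an initial probability law on $\{1,\dots,M\}$ and, for $z\in\mathbb{C}$, let $\Phi_z=W_z\Phi_0$ be its pseudo-wave and $\rho_z=\Phi_z\Phi_z^{T}$ its pseudo-density, as defined in the context. With the dot denoting $d/dz$, they obey $$\dot\Phi_z=K\Phi_z,\qquad \dot\rho_z=[K,\rho_z]=K\rho_z-\rho_zK.$$ Moreover, for all $z$, $$\rho_z^{T}=\rho_z,\qquad \mathrm{Tr}\,\rho_z=\Phi_z^{T}\Phi_z=\Phi_0^{T}\Phi_0,\qquad \rho_z^{2}=(\mathrm{Tr}\,\rho_z)\,\rho_z.$$
   Context: Let $M\ge 2$ and let $Q=(Q_{ij})_{1\le i,j\le M}$ be the generator of an irreducible continuous-time Markov chain: $Q_{ij}\ge0$ for $i\neq j$ and $Q_{ii}=-\sum_{j\ne i}Q_{ij}$. Let $\nu$ be its unique stationary probability vector (strictly positive, $Q^{T}\nu=0$), and assume reversibility (detailed balance): $\nu_iQ_{ij}=\nu_jQ_{ji}$ for all $i,j$. Fix $\Lambda>0$ with $\Lambda\ge\max_i(-Q_{ii})$ and set $P:=\mathrm{I}+\tfrac1\Lambda Q$, $D:=\mathrm{diag}(\sqrt{\nu_1},\dots,\sqrt{\nu_M})$, $A:=DPD^{-1}$ (real symmetric by reversibility). Let $K:=\begin{pmatrix}0&-iA\\ iA&0\end{pmatrix}\in\mathbb{C}^{2M\times 2M}$ and $W_z:=e^{zK}$. Let $\widehat D=\mathrm{diag}(D,D)$, $V=\mathrm{diag}(\mathrm{I}_M,i\,\mathrm{I}_M)$,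 $B:=V\widehat D^{-1}$. For an initial law $\pi_0$ (column vector) put $\widehat\pi_0:=\binom{\pi_0}{0}$, $\Phi_0:=B\widehat\pi_0$, and for $z\in\mathbb{C}$ define the pseudo-wave $\Phi_z:=W_z\Phi_0\in\mathbb{C}^{2M}$ and the pseudo-density $\rho_z:=\Phi_z\Phi_z^{T}$. The superscript $T$ is the plain transpose, with no complex conjugation. *)

(* Defs.v *)
From HB Require Import structures.
From mathcomp Require Import all_boot all_order all_algebra.
From mathcomp Require Import all_classical all_reals all_analysis.
From mathcomp Require Import complex.

Set Implicit Arguments.
Unset Strict Implicit.
Unset Printing Implicit Defensive.

Import Order.TTheory GRing.Theory Num.Theory.
Import numFieldNormedType.Exports.

Local Open Scope classical_set_scope.
Local Open Scope ring_scope.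
Local Open Scope complex_scope.

(* R[i] gets the topology of its modulus and is normed over itself, so that
   [is_derive] at a point of R[i] in direction 1 is the complex derivative. *)
HB.instance Definition _ (R : realType) := PseudoPointedMetric.copy R[i] R[i]^o.
HB.instance Definition _ (R : realType) := NormedModule.copy R[i] R[i]^o.

Section MarkovChain.
Variables (R : realType) (M : nat).
Implicit Types (Q : 'M[R]_M) (p nu : 'cV[R]_M).

Definition prob_vector p : Prop :=
  (forall i, 0 <= p i 0) /\ \sum_i p i 0 = 1.

Definition generator Q : Prop :=
  (forall i j, i != j -> 0 <= Q i j) /\
  (forall i, Q i i = - \sum_(j | j != i) Q i j).

Definition irreducible_chain Q : Prop :=
  forall i j, connect [rel k l | (k != l) && (0 < Q k l)] i j.

Definition stationary Q nu : Prop := prob_vector nu /\ Q^T *m nu = 0.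

Definition reversible Q nu : Prop :=
  forall i j, nu i 0 * Q i j = nu j 0 * Q j i.

Definition uniformized Q (Lambda : R) : 'M[R]_M := 1%:M + Lambda^-1 *: Q.

Definition sqrt_diag nu : 'M[R]_M := diag_mx (\row_i Num.sqrt (nu i 0)).

Definition symmetrized Q nu (Lambda : R) : 'M[R]_M :=
  sqrt_diag nu *m uniformized Q Lambda *m invmx (sqrt_diag nu).

End MarkovChain.

Section MatrixExponential.
Variables (R : realType) (n : nat).

Definition expmx (X : 'M[R[i]]_n) : 'M[R[i]]_n :=
  lim (series (fun k => (k`!%:R)^-1 *: X ^+ k) @ \oo).

End MatrixExponential.

Section PseudoWave.
Variables (R : realType) (M : nat).
Variables (Q : 'M[R]_M) (nu : 'cV[R]_M) (Lambda : R) (pi0 : 'cV[R]_M).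

Local Notation toC := (map_mx (real_complex R)).

Definition wave_gen : 'M[R[i]]_(M + M) :=
  let A := toC (symmetrized Q nu Lambda) in
  block_mx 0 (- ('i *: A)) ('i *: A) 0.

Definition wave_op (z : R[i]) : 'M[R[i]]_(M + M) := expmx (z *: wave_gen).

Definition wave_embedding : 'M[R[i]]_(M + M) :=
  let D := toC (sqrt_diag nu) in
  block_mx 1%:M 0 0 'i%:M *m invmx (block_mx D 0 0 D).

Definition pseudo_wave0 : 'cV[R[i]]_(M + M) :=
  wave_embedding *m col_mx (toC pi0) 0.

Definition pseudo_wave (z : R[i]) : 'cV[R[i]]_(M + M) :=
  wave_op z *m pseudo_wave0.

Definition pseudo_density (z : R[i]) : 'M[R[i]]_(M + M) :=
  pseudo_wave z *m (pseudo_wave z)^T.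

End PseudoWave.

(* Main.v *)
Require Import Defs.
From HB Require Import structures.
From mathcomp Require Import all_boot all_order all_algebra.
From mathcomp Require Import all_classical all_reals all_analysis.
From mathcomp Require Import complex.
From mathcomp Require Import ring.

Set Implicit Arguments.
Unset Strict Implicit.
Unset Printing Implicit Defensive.

Import Order.TTheory GRing.Theory Num.Theory.
Import numFieldNormedType.Exports.

Local Open Scope classical_set_scope.
Local Open Scope ring_scope.
Local Open Scope complex_scope.

(** With [K^T = - K] the flow [W z = exp (z K)] is complex orthogonal,
    and every assertion follows from that and from [W' = K W].

    Antisymmetry of [K] means symmetry of [A = D P D^-1].  Detailed balance
    says [D^2 P = P^T D^2], and conjugating by [D] turns this into [A^T = A].
    Conjugation requires [D] to be invertible, that is [nu] positive: some
    entry of [nu] is positive because they sum to 1, and detailed balance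
    carries positivity along the edges of the chain to every state
    ([reversible_stationary_gt0], [symmetrized_sym], [trmx_wave_gen]).

    The analytic input is the matrix exponential over the complex numbers,
    the limit of the partial sums of its series.  Everything reduces to the real
    exponential by domination: [row_bounded c X] says that the operator norm
    of [X] for the supremum norm is at most [c], and then the [k]-th term of
    the series of [X] is bounded by [c ^ k / k!].
    - The series converges entrywise, since the real and imaginary parts of
      each entry converge absolutely ([cvg_expmx]).
    - For commuting [X] and [Y], the difference between the product of the
      [N]-th partial sums and the [N]-th partial sum for [X + Y] is a sum
      over index pairs in a square that lie beyond its antidiagonal.  Its
      norm is at most the same expression for the real bounds, which tends to
      [e^a e^b - e^(a + b) = 0].  Hence [exp (X + Y) = exp X exp Y] ([expmxD]).
    - The remainder [exp (h X) - 1 - h X] is at most [|h|^2 e^c] for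
      [|h| <= 1], so the derivative at 0 is [X]; the addition formula carries
      it to every point ([is_derive_expmx]).

    The evolution equation of the pseudo-wave is then immediate, and that of
    the pseudo-density is the product rule with [K^T = - K].  Transposition
    commutes with the exponential, so [W^T W = exp (- z K) exp (z K) = 1]
    ([expmx_orthogonal]), which gives conservation of [Phi^T Phi].  Finally
    [Phi Phi^T] has rank at most one, so it squares to its trace times itself
    ([rank1_square]). *)

(** * Limits of complex numbers and complex matrices *)

Section Convergence.
Variable R : realType.
Implicit Types (T : Type) (m n p : nat).

(** A positive complex number is a positive real, so limits in [R[i]] can be
    tested with real tolerances; this is how real estimates enter below. *)
Lemma cvg_complexP T (F : set_system T) (FF : Filter F)
    (f : T -> R[i]) (l : R[i]) :
  f @ F --> l <->
  forall e : R, 0 < e -> \forall x \near F, `|l - f x| <= e%:C.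
Proof.
split=> [/cvgrPdist_le fl e e0|fl].
  by apply: fl; rewrite ltcR.
apply/cvgrPdist_le => -[e e'] /=; rewrite ltcE /= => /andP[/eqP -> e0].
exact: fl.
Qed.

Lemma cvg_mxP T (F : set_system T) (FF : Filter F) m n
    (f : T -> 'M[R[i]]_(m, n)) (L : 'M[R[i]]_(m, n)) :
  f @ F --> L <-> forall i j, f x i j @[x --> F] --> L i j.
Proof.
split=> [fL i j|fL].
  exact: (cvg_comp _ _ fL (@coord_continuous _ _ _ i j L)).
apply/cvg_ballP => e e0.
have h (ij : 'I_m * 'I_n) :
    \forall x \near F, `|L ij.1 ij.2 - f x ij.1 ij.2| < e.
  exact: cvgr_dist_lt (fL _ _) _ e0.
near=> x.
suff fxL ij : `|L ij.1 ij.2 - f x ij.1 ij.2| < e.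
  by split=> // i j; rewrite -ball_normE; exact: (fxL (i, j)).
move: ij; near: x; exact: filter_forall.
Unshelve. all: by end_near. Qed.

Lemma cvg_mulmx T (F : set_system T) (FF : Filter F) m n p
    (f : T -> 'M[R[i]]_(m, n)) (g : T -> 'M[R[i]]_(n, p))
    (A : 'M[R[i]]_(m, n)) (B : 'M[R[i]]_(n, p)) :
  f @ F --> A -> g @ F --> B -> f x *m g x @[x --> F] --> A *m B.
Proof.
move=> /cvg_mxP fA /cvg_mxP gB; apply/cvg_mxP => i j.
rewrite mxE; under eq_fun do rewrite mxE.
apply: cvg_big; first exact: add_continuous.
by move=> k _; apply: cvgM; [exact: fA|exact: gB].
Qed.

Lemma cvg_trmx T (F : set_system T) (FF : Filter F) m n
    (f : T -> 'M[R[i]]_(m, n)) (A : 'M[R[i]]_(m, n)) :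
  f @ F --> A -> (f x)^T @[x --> F] --> A^T.
Proof.
move=> /cvg_mxP fA; apply/cvg_mxP => i j.
by rewrite mxE; under eq_fun do rewrite mxE; exact: fA.
Qed.

Lemma norm_real_complex (x : R) : `|x%:C| = `|x|%:C :> R[i].
Proof. by rewrite normc_def /= expr0n addr0 sqrtr_sqr. Qed.

Lemma cvg_real_complex T (F : set_system T) (FF : Filter F)
    (f : T -> R) (l : R) :
  f @ F --> l -> (f x)%:C @[x --> F] --> l%:C.
Proof.
move=> /cvgrPdist_le fl; apply/cvg_complexP => e e0.
near=> x; rewrite -rmorphB /= norm_real_complex lecR.
by near: x; exact: fl.
Unshelve. all: by end_near. Qed.

(** The real and imaginary parts are dominated by the same real series, so
    completeness of [R] suffices. *)
Lemma cvg_series_complex (u : nat -> R[i]) (a : nat -> R) :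
  (forall k, `|u k| <= (a k)%:C) -> cvgn (series a) -> cvgn (series u).
Proof.
move=> ua ca.
have part (g : R[i] -> R) : (forall x, `|g x|%:C <= `|x|) ->
    cvgn (series (g \o u)).
  move=> gle; apply: normed_cvg; apply: series_le_cvg ca => k //=.
  - by rewrite -lecR; apply: le_trans (ua k); exact: normr_ge0.
  - by rewrite -lecR; exact: le_trans (gle _) (ua k).
have /cvg_real_complex/= cRe := part (@complex.Re R) (@normc_ge_Re R).
(* The imaginary part is minus the real part of the product with 'i. *)
have /cvg_real_complex/= cIm : cvgn (series (@complex.Im R \o u)).
  apply: part => x; rewrite -normrN.
  have := normc_ge_Re (x * 'i); rewrite ReiNIm normrM.
  by rewrite [`|'i|]normc_def /= expr0n expr1n add0r sqrtr1 mulr1.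
apply/cvg_ex; eexists.
have -> : series u = fun n => (series (@complex.Re R \o u) n)%:C +
    'i * (series (@complex.Im R \o u) n)%:C.
  apply/funext => n; rewrite /series /= !rmorph_sum /= mulr_sumr -big_split /=.
  by apply: eq_bigr => k _; exact: complexE.
apply: cvgD; first exact: cRe.
apply: cvgM; [exact: cvg_cst|exact: cIm].
Qed.

End Convergence.

(** * Row-sum bounds *)

Section RowBounds.
Variable R : realType.
Implicit Types (m n p : nat) (a b c : R).

(** An upper bound for the operator norm induced by the supremum norm.  Unlike
    the maximum of the moduli of the entries, it is submultiplicative and gives
    the identity the bound 1 in every dimension, 0 included. *)
Definition row_bounded m n c (X : 'M[R[i]]_(m, n)) : Prop :=
  forall i, \sum_j `|X i j| <= c%:C.

Lemma row_bounded_entry m n c (X : 'M[R[i]]_(m, n)) i j :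
  row_bounded c X -> `|X i j| <= c%:C.
Proof.
move=> Xc; apply: le_trans (Xc i).
by rewrite (bigD1 j) //= lerDl sumr_ge0.
Qed.

Lemma row_bounded_exists m n (X : 'M[R[i]]_(m, n)) :
  exists2 c, 0 <= c & row_bounded c X.
Proof.
have normE (x : R[i]) : `|x| = (complex.Re `|x|)%:C by rewrite normc_def.
exists (complex.Re (\sum_i \sum_j `|X i j|)) => [|i].
  rewrite raddf_sum sumr_ge0// => i _; rewrite raddf_sum sumr_ge0// => j _.
  by rewrite -lecR -normE; exact: normr_ge0.
rewrite RRe_real ?realE ?sumr_ge0// => [|k _]; last exact: sumr_ge0.
by rewrite (bigD1 i) //= lerDl sumr_ge0// => k _; rewrite sumr_ge0.
Qed.

Lemma row_bounded_le m n c d (X : 'M[R[i]]_(m, n)) :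
  c <= d -> row_bounded c X -> row_bounded d X.
Proof. by move=> cd Xc i; apply: le_trans (Xc i) _; rewrite lecR. Qed.

Lemma row_bounded0 m n : row_bounded 0 (0 : 'M[R[i]]_(m, n)).
Proof. by move=> i; rewrite big1// => j _; rewrite mxE normr0. Qed.

Lemma row_boundedD m n a b (X Y : 'M[R[i]]_(m, n)) :
  row_bounded a X -> row_bounded b Y -> row_bounded (a + b) (X + Y).
Proof.
move=> Xa Yb i; rewrite rmorphD /=; apply: le_trans (lerD (Xa i) (Yb i)).
by rewrite -big_split ler_sum// => j _; rewrite mxE ler_normD.
Qed.

Lemma row_bounded_sum m n (I : Type) (r : seq I) (P : pred I) (c : I -> R)
    (X : I -> 'M[R[i]]_(m, n)) :
  (forall k, P k -> row_bounded (c k) (X k)) ->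
  row_bounded (\sum_(k <- r | P k) c k) (\sum_(k <- r | P k) X k).
Proof.
move=> Xc; elim/big_rec2 : _ => [|k x y Pk IH]; first exact: row_bounded0.
exact: row_boundedD (Xc k Pk) IH.
Qed.

Lemma row_boundedZ m n a b (z : R[i]) (X : 'M[R[i]]_(m, n)) :
  `|z| <= a%:C -> row_bounded b X -> row_bounded (a * b) (z *: X).
Proof.
move=> za Xb i; under eq_bigr do rewrite mxE normrM.
rewrite -mulr_sumr rmorphM /=; apply: ler_pM => //; exact: sumr_ge0.
Qed.

Lemma row_boundedM m n p a b (X : 'M[R[i]]_(m, n)) (Y : 'M[R[i]]_(n, p)) :
  0 <= b -> row_bounded a X -> row_bounded b Y -> row_bounded (a * b) (X *m Y).
Proof.
move=> b0 Xa Yb i.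
apply: (@le_trans _ _ (\sum_k `|X i k| * \sum_j `|Y k j|)).
  under [leRHS]eq_bigr do rewrite mulr_sumr.
  rewrite exchange_big ler_sum// => j _; rewrite mxE.
  apply: le_trans (ler_norm_sum _ _ _) _.
  by rewrite ler_sum// => k _; rewrite normrM.
apply: (@le_trans _ _ (\sum_k `|X i k| * b%:C)).
  by rewrite ler_sum// => k _; rewrite ler_wpM2l.
by rewrite -mulr_suml rmorphM /= ler_wpM2r// (lecR 0).
Qed.

Lemma row_bounded1 n : row_bounded 1 (1%:M : 'M[R[i]]_n).
Proof.
move=> i; rewrite (bigD1 i)//= big1 ?addr0 => [|j ji].
  by rewrite mxE eqxx normr1.
by rewrite mxE eq_sym (negbTE ji) normr0.
Qed.

Lemma row_boundedX n c (X : 'M[R[i]]_n) k :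
  0 <= c -> row_bounded c X -> row_bounded (c ^+ k) (X ^+ k).
Proof.
move=> c0 Xc; elim: k => [|k IHk]; first exact: row_bounded1.
by rewrite !exprS; apply: row_boundedM; rewrite ?exprn_ge0.
Qed.

(** Moduli of complex numbers are compared in the partial order of [R[i]],
    where passing to the limit in an inequality is done through the reals. *)
Lemma norm_lim_le T (F : set_system T) (FF : ProperFilter F)
    (f : T -> R[i]) (l : R[i]) c :
  f @ F --> l -> (\forall x \near F, `|f x| <= c%:C) -> `|l| <= c%:C.
Proof.
move=> /cvg_complexP fl fc.
rewrite normc_def lecR; apply/ler_addgt0Pr => e e0.
rewrite -lecR -normc_def rmorphD /= addrC.
have /filter_ex [x [lx xc]] :
    \forall x \near F, `|l - f x| <= e%:C /\ `|f x| <= c%:C.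
  by near=> x; split; near: x => //; exact: fl.
by rewrite -[l](subrK (f x)); apply: le_trans (ler_normD _ _) (lerD lx xc).
Unshelve. all: by end_near. Qed.

End RowBounds.

(** * Terms of the exponential series and the Cauchy product *)

(** A square of indices splits into the antidiagonals [i + j = k] with [k < n],
    which make up the Cauchy product, and the remaining corner. *)
Lemma sum_square_split (V : nmodType) (F : nat -> nat -> V) n :
  \sum_(i < n) \sum_(j < n) F i j =
    \sum_(k < n) \sum_(i < k.+1) F (k - i)%N i +
    \sum_(i < n) \sum_(j < n | (n <= i + j)%N) F i j.
Proof.
have -> : \sum_(k < n) \sum_(i < k.+1) F (k - i)%N i =
    \sum_(i < n) \sum_(j < n | ~~ (n <= i + j)%N) F i j.
  under eq_bigr => k _.
    rewrite (reindex_inj rev_ord_inj) /=.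
    under eq_bigr => i _ do rewrite subSS subKn 1?leq_ord//.
    rewrite (big_ord_widen n (fun i => F i (k - i)%N))//.
    over.
  rewrite (exchange_big_dep xpredT)//=.
  apply: eq_bigr => i _.
  rewrite [RHS](eq_bigl (fun j : 'I_n => j < n - i)%N); last first.
    by move=> j; rewrite -ltnNge ltn_subRL.
  rewrite -(big_ord_widen n (fun j => F i j)) ?leq_subr//.
  transitivity (\sum_(i <= k < n) F i (k - i)%N).
    by rewrite big_geq_mkord; apply: eq_bigl => k; rewrite ltnS.
  rewrite -{1}[val i]add0n big_addn big_mkord.
  by apply: eq_bigr => j _; rewrite addnK.
rewrite -big_split; apply: eq_bigr => i _ /=.
by rewrite (bigID (fun j : 'I_n => n <= i + j)%N) /= addrC.
Qed.

Section ExponentialCoefficients.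
Variables (K : numFieldType) (n : nat).
Implicit Types X Y : 'M[K]_n.

Definition expmx_coeff X k : 'M[K]_n := (k`!%:R)^-1 *: X ^+ k.

(** Binomial theorem divided by [k!]. *)
Lemma expmx_coeffD X Y k : GRing.comm X Y ->
  expmx_coeff (X + Y) k =
    \sum_(i < k.+1) expmx_coeff X (k - i)%N *m expmx_coeff Y i.
Proof.
move=> XY; rewrite /expmx_coeff exprDn_comm// scaler_sumr.
apply: eq_bigr => i _.
rewrite -scalemxAl -scalemxAr -[_ * _ *+ _]scaler_nat !scalerA mulmxE.
congr (_ *: _).
have ik : (i <= k)%N by rewrite -ltnS.
rewrite -(bin_fact ik) !natrM.
have f0 m : (m`!%:R : K) != 0 by rewrite pnatr_eq0 -lt0n fact_gt0.
have b0 : ('C(k, i)%:R : K) != 0 by rewrite pnatr_eq0 -lt0n bin_gt0.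
by field; rewrite !f0 b0.
Qed.

(** The partial sums of the exponential are multiplicative up to the terms of
    the corner [N <= i + j]. *)
Lemma expmx_seriesD_defect X Y N : GRing.comm X Y ->
  (\sum_(k < N) expmx_coeff X k) *m (\sum_(k < N) expmx_coeff Y k) -
    \sum_(k < N) expmx_coeff (X + Y) k =
  \sum_(i < N) \sum_(j < N | (N <= i + j)%N) expmx_coeff X i *m expmx_coeff Y j.
Proof.
move=> XY; rewrite mulmx_suml.
under eq_bigr do rewrite mulmx_sumr.
rewrite (sum_square_split (fun i j => expmx_coeff X i *m expmx_coeff Y j)).
under [X in _ + _ - X]eq_bigr do rewrite expmx_coeffD//.
by rewrite addrAC subrr add0r.
Qed.

Lemma expmx_coeffZ (z : K) X k :
  expmx_coeff (z *: X) k = z ^+ k *: expmx_coeff X k.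
Proof.
rewrite /expmx_coeff scalerA mulrC -scalerA; congr (_ *: _).
elim: k => [|k IHk]; first by rewrite !expr0 scale1r.
by rewrite !exprS IHk -mulmxE -scalemxAl -scalemxAr scalerA.
Qed.

Lemma trmx_expmx_coeff X k : (expmx_coeff X k)^T = expmx_coeff X^T k.
Proof.
rewrite /expmx_coeff linearZ /=; congr (_ *: _).
elim: k => [|k IHk]; first by rewrite !expr0 trmx1.
by rewrite exprS exprSr -mulmxE trmx_mul IHk.
Qed.

(** The two subtracted terms are those of index 0 and 1. *)
Lemma expmx_sum2 X (h : K) N :
  \sum_(k < N.+2) expmx_coeff (h *: X) k - 1%:M - h *: X =
    \sum_(k < N) h ^+ k.+2 *: expmx_coeff X k.+2.
Proof.
rewrite 2!big_ord_recl /= addrA {1}/expmx_coeff invr1 scale1r expr0.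
rewrite expmx_coeffZ {1}/expmx_coeff invr1 scale1r !expr1.
under eq_bigr do rewrite expmx_coeffZ.
have cancel3 (A B S : 'M[K]_n) : A + B + S - A - B = S.
  by rewrite -[_ - A - B]addrA -opprD addrAC subrr add0r.
exact: cancel3.
Qed.

End ExponentialCoefficients.

(** * Convergence and addition formula *)

Section Exponential.
Variables (R : realType) (n : nat).
Implicit Types (X Y : 'M[R[i]]_n) (c : R) (N : nat).

Local Notation E := (fun X N => series (expmx_coeff X) N).
Local Notation e := (fun x N => series (@exp_coeff R x) N).

Lemma row_bounded_expmx_coeff c X k :
  0 <= c -> row_bounded c X -> row_bounded (exp_coeff c k) (expmx_coeff X k).
Proof.
move=> c0 Xc; rewrite /exp_coeff/= mulrC.
apply: row_boundedZ; last exact: row_boundedX.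
by rewrite normfV normr_nat -[leLHS]/((k`!%:R)^-1) fmorphV rmorph_nat.
Qed.

Lemma cvg_expmx X : E X @ \oo --> expmx X.
Proof.
rewrite /expmx -/(series _) -/(expmx_coeff X).
have [c c0 Xc] := row_bounded_exists X.
suff : cvgn (series (expmx_coeff X)) by [].
have entry i j : cvgn (series (fun k => expmx_coeff X k i j)).
  apply: (@cvg_series_complex _ _ (exp_coeff c)) => [k|].
    exact/row_bounded_entry/row_bounded_expmx_coeff.
  exact: is_cvg_series_exp_coeff.
apply/cvg_ex.
exists (\matrix_(i, j) limn (series (fun k => expmx_coeff X k i j))).
apply/cvg_mxP => i j; rewrite mxE.
under eq_fun do rewrite summxE.
exact: entry.
Qed.

Lemma exp_coeffD (x y : R) k :
  exp_coeff (x + y) k = \sum_(i < k.+1) exp_coeff x (k - i)%N * exp_coeff y i.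
Proof.
rewrite /exp_coeff /= exprDn mulr_suml; apply: eq_bigr => i _.
have ik : (i <= k)%N by rewrite -ltnS.
rewrite -(bin_fact ik) !natrM -mulr_natr.
have f0 m : (m`!%:R : R) != 0 by rewrite pnatr_eq0 -lt0n fact_gt0.
have b0 : ('C(k, i)%:R : R) != 0 by rewrite pnatr_eq0 -lt0n bin_gt0.
by field; rewrite !f0 b0.
Qed.

(** The corner of the real series has the same shape as that of the matrix
    series, hence dominates it term by term. *)
Lemma exp_seriesD_defect (x y : R) N :
  (\sum_(k < N) exp_coeff x k) * (\sum_(k < N) exp_coeff y k) -
    \sum_(k < N) exp_coeff (x + y) k =
    \sum_(i < N) \sum_(j < N | (N <= i + j)%N) exp_coeff x i * exp_coeff y j.
Proof.
rewrite mulr_suml.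
under eq_bigr do rewrite mulr_sumr.
rewrite (sum_square_split (fun i j => exp_coeff x i * exp_coeff y j)).
under [X in _ + _ - X]eq_bigr do rewrite exp_coeffD.
by rewrite addrAC subrr add0r.
Qed.

Lemma row_bounded_expmxD_defect a b X Y N :
  0 <= a -> 0 <= b -> row_bounded a X -> row_bounded b Y -> GRing.comm X Y ->
  row_bounded (e a N * e b N - e (a + b) N) (E X N *m E Y N - E (X + Y) N).
Proof.
move=> a0 b0 Xa Yb XY; rewrite /series /= !big_mkord.
rewrite exp_seriesD_defect expmx_seriesD_defect//.
apply: row_bounded_sum => i _; apply: row_bounded_sum => j _.
apply: row_boundedM; first exact: exp_coeff_ge0.
  exact: row_bounded_expmx_coeff.
exact: row_bounded_expmx_coeff.
Qed.

(** The real exponential satisfies the addition formula, so the defect of its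
    partial sums tends to 0, and so does the matrix defect that it bounds. *)
Lemma expmxD X Y : GRing.comm X Y -> expmx (X + Y) = expmx X *m expmx Y.
Proof.
move=> XY.
have [a a0 Xa] := row_bounded_exists X; have [b b0 Yb] := row_bounded_exists Y.
apply/esym/eqP; rewrite -subr_eq0; apply/eqP.
have lim1 : E X N *m E Y N - E (X + Y) N @[N --> \oo] -->
    expmx X *m expmx Y - expmx (X + Y).
  by apply: cvgB; [apply: cvg_mulmx|]; exact: cvg_expmx.
apply: norm_cvg_unique lim1 _.
have lim2 : e a N * e b N - e (a + b) N @[N --> \oo] --> (0 : R).
  rewrite -(subrr (expR (a + b))) {1}expRD.
  by apply: cvgB; [apply: cvgM|]; exact: is_cvg_series_exp_coeff.
move/cvgrPdist_le : lim2 => lim2.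
apply/cvg_mxP => i j; apply/cvg_complexP => eps eps0.
near=> N; rewrite mxE sub0r normrN.
have defect := row_bounded_expmxD_defect N a0 b0 Xa Yb XY.
apply: le_trans (row_bounded_entry _ _ defect) _.
rewrite lecR; apply: le_trans (ler_norm _) _.
by rewrite -normrN -[- (_ - _)]sub0r; near: N; exact: lim2.
Unshelve. all: by end_near. Qed.

Lemma expmx0 : expmx (0 : 'M[R[i]]_n) = 1%:M.
Proof.
apply: norm_cvg_unique (@cvg_expmx 0) _.
apply: cvg_near_cst; exists 1%N => // -[|N] // _.
rewrite /series /= big_nat_recl //= /expmx_coeff expr0 invr1 scale1r.
rewrite big1 ?addr0 // => k _.
by rewrite exprS mul0r scaler0.
Qed.

Lemma trmx_expmx X : (expmx X)^T = expmx X^T.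
Proof.
have lim_tr : (E X N)^T @[N --> \oo] --> (expmx X)^T.
  by apply: cvg_trmx; exact: cvg_expmx.
apply: norm_cvg_unique lim_tr _.
suff -> : (fun N => (E X N)^T) = E X^T by exact: cvg_expmx.
apply/funext => N; rewrite /series /= raddf_sum; apply: eq_bigr => k _ /=.
exact: trmx_expmx_coeff.
Qed.

End Exponential.

(** * Derivative of the exponential *)

Lemma is_derive_cvg (K : numFieldType) (V W : normedModType K)
    (f : V -> W) a v df :
  h^-1 *: (f (h *: v + a) - f a) @[h --> 0^'] --> df -> is_derive a v f df.
Proof.
move=> fdf; split; first by apply/cvg_ex; exists df.
exact: cvg_lim fdf.
Qed.

Section ExponentialDerivative.
Variables (R : realType) (n : nat).
Implicit Types (X Y : 'M[R[i]]_n) (c r : R).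

(** For [k >= 2] and [r <= 1] one has [r ^ k <= r ^ 2], so the remainder is
    at most [r ^ 2] times the exponential series of [c]. *)
Lemma expmx_remainder_le X c r (h : R[i]) i j :
  0 <= c -> row_bounded c X -> `|h| <= r%:C -> r <= 1 ->
  `|(expmx (h *: X) - 1%:M - h *: X) i j| <= (r ^+ 2 * expR c)%:C.
Proof.
move=> c0 Xc hr r1.
have r0 : 0 <= r by rewrite -lecR; exact: le_trans (normr_ge0 _) hr.
have lim_rem :
    (series (expmx_coeff (h *: X)) N - 1%:M - h *: X) i j @[N --> \oo] -->
    (expmx (h *: X) - 1%:M - h *: X) i j.
  have : series (expmx_coeff (h *: X)) N - 1%:M - h *: X @[N --> \oo] -->
    expmx (h *: X) - 1%:M - h *: X.
    apply: cvgB; last exact: cvg_cst.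
    apply: cvgB; last exact: cvg_cst.
    exact: cvg_expmx.
  by move=> /cvg_mxP.
apply: norm_lim_le lim_rem _; near=> N.
have [m ->] : exists m, N = m.+2.
  by exists N.-2; near: N; exists 2%N => // -[|[|N]].
rewrite /series /= big_mkord expmx_sum2.
apply: row_bounded_entry.
apply: (@row_bounded_le _ _ _ (\sum_(k < m) r ^+ k.+2 * exp_coeff c k.+2)).
  apply: (@le_trans _ _ (r ^+ 2 * \sum_(k < m) exp_coeff c k.+2)).
    rewrite mulr_sumr ler_sum// => k _; rewrite ler_wpM2r ?exp_coeff_ge0//.
    exact: ler_wiXn2l.
  rewrite ler_wpM2l ?exprn_ge0//.
  apply: (@le_trans _ _ (series (exp_coeff c) m.+2)).
    rewrite /series /= big_mkord 2!big_ord_recl /= addrA lerDr.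
    by rewrite addr_ge0// exp_coeff_ge0.
  apply: nondecreasing_cvgn_le; last exact: is_cvg_series_exp_coeff.
  apply: nondecreasing_series => k _ _; exact: exp_coeff_ge0.
apply: row_bounded_sum => k _; apply: row_boundedZ.
  by rewrite normrX rmorphXn /= lerXn2r// nnegrE// (lecR 0).
exact: row_bounded_expmx_coeff.
Unshelve. all: by end_near. Qed.

Lemma cvg_expmx_quotient X :
  h^-1 *: (expmx (h *: X) - 1%:M) @[h --> (0 : R[i])^'] --> X.
Proof.
have [c c0 Xc] := row_bounded_exists X.
apply/cvg_mxP => i j; apply/cvg_complexP => e e0.
(* The quotient differs from X by at most |h| e^c, for |h| <= 1. *)
set d : R := Num.min 1 (e / expR c).
have d0 : 0 < d by rewrite lt_min ltr01 divr_gt0 ?expR_gt0.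
near=> h.
have h0 : h != 0 by near: h; exact: nbhs_dnbhs_neq.
have hd : `|h| < d%:C by near: h; apply: dnbhs0_lt; rewrite (ltcR 0).
set r := complex.Re `|h|.
have hr : `|h| = r%:C by rewrite /r normc_def.
have [r1 re] : r <= 1 /\ r <= e / expR c.
  by apply/andP; rewrite -le_min -/d -lecR -hr ltW.
have r0 : 0 < r by rewrite -(ltcR 0) -hr normr_gt0.
have -> : X i j - (h^-1 *: (expmx (h *: X) - 1%:M)) i j =
    - (h^-1 * (expmx (h *: X) - 1%:M - h *: X) i j).
  by rewrite !mxE; field.
rewrite normrN normrM normfV hr.
rewrite ler_pdivrMl ?(ltcR 0)//.
have hle : `|h| <= r%:C by rewrite hr.
apply: le_trans (expmx_remainder_le i j c0 Xc hle r1) _.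
rewrite -rmorphM /= lecR expr2 -mulrA ler_wpM2l ?(ltW r0)//.
by rewrite -ler_pdivlMr ?expR_gt0.
Unshelve. all: by end_near. Qed.

(** [exp ((z + h) X) - exp (z X) = (exp (h X) - 1) exp (z X)], so only the
    derivative at 0 is needed. *)
Lemma is_derive_expmx X (z : R[i]) :
  is_derive z 1 (fun w : R[i] => expmx (w *: X)) (X *m expmx (z *: X)).
Proof.
apply: is_derive_cvg.
have -> : (fun h : R[i] =>
      h^-1 *: (expmx ((h *: 1 + z) *: X) - expmx (z *: X))) =
    (fun h => (h^-1 *: (expmx (h *: X) - 1%:M)) *m expmx (z *: X)).
  apply/funext => h; rewrite -scalemxAl mulmxBl mul1mx -expmxD.
    by rewrite -scalerDl [h *: 1]mulr1.
  by rewrite /GRing.comm -mulmxE -!scalemxAl -!scalemxAr !scalerA mulrC.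
by apply: cvg_mulmx; [exact: cvg_expmx_quotient|exact: cvg_cst].
Qed.

End ExponentialDerivative.

Section DerivativeRules.
Variable R : realType.

Lemma is_derive_trmx m n (F : R[i] -> 'M[R[i]]_(m, n)) (z : R[i])
    (dF : 'M[R[i]]_(m, n)) :
  is_derive z 1 F dF -> is_derive z 1 (fun w => (F w)^T) dF^T.
Proof.
move=> [FdF <-]; apply: is_derive_cvg.
have -> : (fun h : R[i] => h^-1 *: ((F (h *: 1 + z))^T - (F z)^T)) =
    (fun h => (h^-1 *: (F (h *: 1 + z) - F z))^T).
  by apply/funext => h; apply/matrixP => i j; rewrite !mxE.
by apply: cvg_trmx; exact: FdF.
Qed.

(** The usual splitting of the difference quotient of a product, with the
    second factor continuous because it is differentiable. *)
Lemma is_derive_mulmx m n p (F : R[i] -> 'M[R[i]]_(m, n))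
    (G : R[i] -> 'M[R[i]]_(n, p)) (z : R[i])
    (dF : 'M[R[i]]_(m, n)) (dG : 'M[R[i]]_(n, p)) :
  is_derive z 1 F dF -> is_derive z 1 G dG ->
  is_derive z 1 (fun w => F w *m G w) (dF *m G z + F z *m dG).
Proof.
move=> [FdF <-] [GdG <-]; apply: is_derive_cvg.
have Gz : G (h *: 1 + z) @[h --> (0 : R[i])^'] --> G z.
  have Gc : {for z, continuous G}.
    by apply/differentiable_continuous/derivable1_diffP; exact: GdG.
  have hz : h *: 1 + z @[h --> (0 : R[i])^'] --> z.
    apply/cvg_complexP => e e0; near=> h.
    rewrite [h *: 1]mulr1 opprD addrCA subrr addr0 normrN.
    by near: h; apply: dnbhs0_le; rewrite (ltcR 0).
  exact: (cvg_comp _ _ hz Gc).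
have -> : (fun h : R[i] =>
      h^-1 *: (F (h *: 1 + z) *m G (h *: 1 + z) - F z *m G z)) =
    (fun h => (h^-1 *: (F (h *: 1 + z) - F z)) *m G (h *: 1 + z) +
              F z *m (h^-1 *: (G (h *: 1 + z) - G z))).
  apply/funext => h; rewrite -scalemxAl -scalemxAr -scalerDr mulmxBl mulmxBr.
  by rewrite addrA subrK.
apply: cvgD; first by apply: cvg_mulmx; [exact: FdF|exact: Gz].
by apply: cvg_mulmx; [exact: cvg_cst|exact: GdG].
Unshelve. all: by end_near. Qed.

End DerivativeRules.

(** * Reversibility and symmetry *)

Section ReversibleChain.
Variables (R : realType) (M : nat).
Implicit Types (Q : 'M[R]_M) (nu : 'cV[R]_M).

(** If [nu k > 0] and [Q k l > 0], then [nu l * Q l k = nu k * Q k l > 0] forces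
    [nu l] to be nonzero; irreducibility lets this reach every state. *)
Lemma reversible_stationary_gt0 Q nu :
  irreducible_chain Q -> stationary Q nu -> reversible Q nu ->
  forall i, 0 < nu i 0.
Proof.
move=> irr [[nu_ge0 nu_sum] _] rev.
have [i0 nui0] : exists i, 0 < nu i 0.
  apply: contrapT => nu_le0.
  have := oner_neq0 R; rewrite -nu_sum big1 ?eqxx// => i _.
  apply/eqP; rewrite eq_le nu_ge0 andbT leNgt; apply/negP => nui.
  by apply: nu_le0; exists i.
move=> i; have /connectP[s + ->] := irr i0 i.
elim: s i0 nui0 => //= l s IHs k nuk /andP[/andP[_ Qkl] ls]; apply: IHs ls.
rewrite lt_neqAle nu_ge0 andbT eq_sym; apply/eqP => nul0.
by have := mulr_gt0 nuk Qkl; rewrite rev nul0 mul0r ltxx.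
Qed.

(** [D * D] is the diagonal matrix of [nu], so detailed balance reads
    [D * D * P = P^T * D * D]; multiplying by the inverse of [D] on both sides
    gives the symmetry of [D * P * D^-1]. *)
Lemma symmetrized_sym Q nu (Lambda : R) :
  (forall i, 0 < nu i 0) -> reversible Q nu ->
  (symmetrized Q nu Lambda)^T = symmetrized Q nu Lambda.
Proof.
move=> nu_gt0 rev; rewrite /symmetrized.
set D := sqrt_diag nu; set P := uniformized _ _.
have Dunit : D \in unitmx.
  rewrite unitmxE det_diag unitfE; apply/prodf_neq0 => i _.
  by rewrite mxE sqrtr_eq0 -ltNge.
have DT : D^T = D by rewrite tr_diag_mx.
have balance : D *m D *m P = P^T *m D *m D.
  have DD : D *m D = diag_mx nu^T.
    rewrite mulmx_diag; congr diag_mx; apply/rowP => i.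
    by rewrite !mxE -expr2 sqr_sqrtr// ltW.
  rewrite -[RHS]mulmxA DD; apply/matrixP => i j.
  rewrite mul_diag_mx mul_mx_diag !mxE.
  rewrite [RHS]mulrC !mulrDr ![_ * (Lambda^-1 * _)]mulrCA rev; congr (_ + _).
  by rewrite eq_sym; case: eqVneq => [->|]; rewrite ?mulr0.
rewrite !trmx_mul trmx_inv DT.
apply: (can_inj (mulKmx Dunit)); apply: (can_inj (mulmxK Dunit)).
by rewrite mulKVmx// -[RHS]mulmxA mulmxKV// mulmxA balance.
Qed.

End ReversibleChain.

(** * The pseudo-wave and its density *)

(** The inner factor [v^T *m v] is a scalar, equal to the trace. *)
Lemma rank1_square (K : numFieldType) m (v : 'cV[K]_m) :
  v *m v^T *m (v *m v^T) = \tr (v *m v^T) *: (v *m v^T).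
Proof.
rewrite mulmxA -[v *m v^T *m v]mulmxA mxtrace_mulC [v^T *m v]mx11_scalar.
by rewrite mul_mx_scalar mxtrace_scalar mulr1n -scalemxAl.
Qed.

Lemma trmx_wave_gen (R : realType) M (Q : 'M[R]_M) nu (Lambda : R) :
  (symmetrized Q nu Lambda)^T = symmetrized Q nu Lambda ->
  (wave_gen Q nu Lambda)^T = - wave_gen Q nu Lambda.
Proof.
move=> symA; rewrite /wave_gen tr_block_mx opp_block_mx !trmx0 !oppr0.
by rewrite opprK linearN /= linearZ /= map_trmx symA.
Qed.

(** The transpose of [exp (z K)] is [exp (- z K)], its inverse. *)
Lemma expmx_orthogonal (R : realType) n (K : 'M[R[i]]_n) (z : R[i]) :
  K^T = - K -> (expmx (z *: K))^T *m expmx (z *: K) = 1%:M.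
Proof.
move=> KT; rewrite trmx_expmx linearZ /= KT -expmxD.
  by rewrite scalerN addNr expmx0.
by rewrite scalerN /GRing.comm mulrN mulNr.
Qed.

Theorem theorem5p2 (R : realType) (M : nat) (M_ge2 : (2 <= M)%N)
    (Q : 'M[R]_M) (nu : 'cV[R]_M) (Lambda : R) (pi0 : 'cV[R]_M)
    (Q_gen : generator Q) (Q_irr : irreducible_chain Q)
    (nu_stat : stationary Q nu) (Q_rev : reversible Q nu)
    (Lambda_gt0 : 0 < Lambda) (Lambda_ge : forall i, - Q i i <= Lambda)
    (pi0_prob : prob_vector pi0) :
  let K := wave_gen Q nu Lambda in
  let Phi0 := pseudo_wave0 nu pi0 in
  let Phi := pseudo_wave Q nu Lambda pi0 in
  let rho := pseudo_density Q nu Lambda pi0 in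
  forall z : R[i],
    is_derive z 1 Phi (K *m Phi z) /\
    is_derive z 1 rho (K *m rho z - rho z *m K) /\
    (rho z)^T = rho z /\
    \tr (rho z) = ((Phi z)^T *m Phi z) 0 0 /\
    ((Phi z)^T *m Phi z) 0 0 = (Phi0^T *m Phi0) 0 0 /\
    rho z *m rho z = \tr (rho z) *: rho z.
Proof.
move=> K Phi0 Phi rho z.
have KT : K^T = - K.
  apply: trmx_wave_gen; apply: symmetrized_sym => //.
  exact: reversible_stationary_gt0 nu_stat Q_rev.
have dPhi : is_derive z 1 Phi (K *m Phi z).
  have <- : K *m expmx (z *: K) *m Phi0 + expmx (z *: K) *m 0 = K *m Phi z.
    by rewrite mulmx0 addr0 -mulmxA.
  exact: is_derive_mulmx (is_derive_expmx K z) (is_derive_cst Phi0 z 1).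
have norm1 : (Phi z)^T *m Phi z = Phi0^T *m Phi0.
  rewrite /Phi /pseudo_wave trmx_mul mulmxA.
  by rewrite -[_ *m _ *m wave_op _ _ _ _]mulmxA expmx_orthogonal// mulmx1.
split=> //; split; last split; last split; last split.
- rewrite /rho /pseudo_density -/Phi.
  have <- : K *m Phi z *m (Phi z)^T + Phi z *m (K *m Phi z)^T =
      K *m (Phi z *m (Phi z)^T) - Phi z *m (Phi z)^T *m K.
    by rewrite [(K *m _)^T]trmx_mul KT !mulmxN !mulmxA.
  exact: is_derive_mulmx dPhi (is_derive_trmx dPhi).
- by rewrite /rho /pseudo_density -/Phi [LHS]trmx_mul trmxK.
- by rewrite mxtrace_mulC [in LHS](mx11_scalar (_ *m _)) mxtrace_scalar mulr1n.
- by rewrite norm1.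
- exact: rank1_square.
Qed.
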